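(* Let $r\ge 1$, $n\ge 2r$ be integers and $m=\lfloor n/r\rfloor$. Consider a graph $\mathcal{G}=(\mathcal{V},\mathcal{E}_1,\mathcal{E}_2)$ with $m$ vertices for which the subgraph $\mathcal{G}_1=(\mathcal{V},\mathcal{E}_1)$ is connected and non-bipartite. Assume that there exists a maximal independent set $\mathcal{S}=\mathcal{S}(\mathcal{G}_1)$ of $\mathcal{G}_1$ whose vertices each have a self-loop (in $\mathcal{G}_1$), and that the induced subgraph $\mathcal{G}_2[\mathcal{S}]$ of $\mathcal{G}_2=(\mathcal{V},\mathcal{E}_2)$ is connected. Let $g:\mathbb{R}^{n\times n}\to\mathbb{R}$ be such that (i) $g$ is twice continuously differentiable; (ii) the zero matrix $\mathbf{0}_{n\times n}$ is the unique minimizer of $g$; (iii) the Hessian of $g$ at $\mathbf{0}_{n\times n}$ is positive definite. Then there exists an instance $\mathcal{P}_{\mathbf{M}^*,\Omega,n,r}$ in $\mathcal{L}(\mathcal{G},n,r)$ for which the problem $\min_{\mathbf{X}\in\mathbb{R}^{n\times r}} g[(\mathbf{X}\mathbf{X}^T-\mathbf{M}^* )_\Omega]$ has at least $2^{r(|\mathcal{S}(\mathcal{G}_1)|-1)}-1$ equivalence classes of spurious local minima.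
   Context: $[m]=\{1,\dots,m\}$; $\mathbb{S}^n_+$ is the set of $n\times n$ real PSD matrices. For $\Omega\subset[n]\times[n]$, $\mathbf{M}_\Omega$ denotes the matrix whose $(i,j)$ entry is $\mathbf{M}_{ij}$ if $(i,j)\in\Omega$ and $0$ otherwise. The matrix completion problem $\mathcal{P}_{\mathbf{M}^*,\Omega,n,r}$ is: find $\mathbf{M}\in\mathbb{R}^{n\times n}$ with $\mathrm{rank}(\mathbf{M})\le r$, $\mathbf{M}\succeq 0$, $\mathbf{M}_\Omega=\mathbf{M}^*_\Omega$. With $m=\lfloor n/r\rfloor$, the first $mr$ rows and columns of an $n\times n$ matrix $\mathbf{M}^*$ are divided into $m\times m$ blocks of size $r\times r$; the block at position $(i,j)$ is $\mathbf{M}^*_{i,j}$. Let $\mathcal{G}=(\mathcal{G}_1,\mathcal{G}_2)=(\mathcal{V},\mathcal{E}_1,\mathcal{E}_2)$ be a pair of undirected graphs (self-loops allowed) on $\mathcal{V}=[m]$ with disjoint edge sets $\mathcal{E}_1,\mathcal{E}_2\subset[m]\times[m]$. The induced measurement set $\Omega(\mathcal{G})$ is: if $(i,j)\in\mathcal{E}_1$, all entries of block $(i,j)$ are observed; if $(i,j)\in\mathcal{E}_2$, all nondiagonal entries of the block $(i,j)$ are observed; otherwise no entry of the block is observed; in addition, the last $n-mr$ rows and columns are fully observed. The class $\mathcal{L}(\mathcal{G},n,r)$ consists of the problems $\mathcal{P}_{\mathbf{M}^*,\Omega,n,r}$ such that: (i) $\mathbf{M}^*\in\mathbb{S}^n_+$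 has rank $r$; (ii) $\mathbf{M}^*_{i,j}$ has rank $r$ for all $i,j\in[m]$; (iii) $\Omega=\Omega(\mathcal{G})$ with $\mathcal{G}_1$ connected and non-bipartite (a self-loop counts as an odd cycle). An independent set is a set of nodes no two (distinct) of which are adjacent; it is maximal if it is not a strict subset of another independent set. A solution is spurious if it is a local minimum with objective value larger than the optimal objective value. Two points $\mathbf{X},\mathbf{X}'\in\mathbb{R}^{n\times r}$ are equivalent if $\mathbf{X}'=\mathbf{X}\mathbf{Q}$ for some orthogonal $\mathbf{Q}\in\mathbb{R}^{r\times r}$. *)

(* Defs.v *)
From HB Require Import structures.
From mathcomp Require Import all_boot all_order all_algebra.
From mathcomp Require Import all_classical all_reals all_analysis.

Set Implicit Arguments.
Unset Strict Implicit.
Unset Printing Implicit Defensive.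

Import Order.TTheory GRing.Theory Num.Theory.
Import numFieldNormedType.Exports.

Local Open Scope classical_set_scope.
Local Open Scope ring_scope.

(* Undirected graphs are symmetric relations; [e x x] is a self-loop at [x]. *)

Definition graph_connected (T : finType) (e : rel T) : bool :=
  [forall x, forall y, connect e x y].

(* A self-loop at [x] would require [c x != c x], so it excludes bipartiteness. *)
Definition bipartite (T : finType) (e : rel T) : Prop :=
  exists c : T -> bool, forall x y, e x y -> c x != c y.

(* Self-loops do not prevent a set from being independent. *)
Definition independent (T : finType) (e : rel T) (S : {set T}) : bool :=
  [forall x in S, forall y in S, (x != y) ==> ~~ e x y].

Definition maximal_independent (T : finType) (e : rel T) (S : {set T}) : bool :=
  maxset (independent e) S.

Definition induced (T : finType) (e : rel T) (S : {set T}) : rel T :=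
  [rel x y | [&& x \in S, y \in S & e x y]].

Definition induced_connected (T : finType) (e : rel T) (S : {set T}) : bool :=
  [forall x in S, forall y in S, connect (induced e S) x y].

Record graph_pair (m : nat) := GraphPair {
  edge1 : rel 'I_m;
  edge2 : rel 'I_m;
  edge1_sym : symmetric edge1;
  edge2_sym : symmetric edge2;
  edge_disjoint : forall i j, ~~ (edge1 i j && edge2 i j) }.

(* Indices are 0-based: entry [(a, b)] of block [(i, j)] sits in row
   [i * r + a] and column [j * r + b]. *)

Lemma block_index_subproof (n r : nat) (i : 'I_(n %/ r)) (a : 'I_r) :
  (i * r + a < n)%N.
Proof.
apply: (@leq_trans (i.+1 * r)); first by rewrite mulSn addnC ltn_add2r.
by apply: leq_trans (leq_divM n r); rewrite leq_mul2r ltn_ord orbT.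
Qed.

Definition block_index (n r : nat) (i : 'I_(n %/ r)) (a : 'I_r) : 'I_n :=
  Ordinal (block_index_subproof i a).

Definition block (R : Type) (n r : nat) (M : 'M[R]_n) (i j : 'I_(n %/ r)) :
    'M[R]_r :=
  \matrix_(a, b) M (block_index i a) (block_index j b).

Definition induced_measurements (n r : nat) (G : graph_pair (n %/ r)) :
    {set 'I_n * 'I_n} :=
  [set p : 'I_n * 'I_n |
    [|| (n %/ r * r <= p.1)%N, (n %/ r * r <= p.2)%N |
     [exists i : 'I_(n %/ r), exists j : 'I_(n %/ r),
      exists a : 'I_r, exists b : 'I_r,
       (p == (block_index i a, block_index j b))
       && (edge1 G i j || (edge2 G i j && (a != b)))]]].

Definition psd (R : realType) (n : nat) (M : 'M[R]_n) : Prop :=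
  M^T = M /\ forall v : 'rV[R]_n, 0 <= (v *m M *m v^T) 0 0.

Definition mask (R : realType) (n : nat) (Om : {set 'I_n * 'I_n})
    (M : 'M[R]_n) : 'M[R]_n :=
  \matrix_(i, j) if (i, j) \in Om then M i j else 0.

(* A problem instance for given [n] and [r] is identified with its data
   [(Mstar, Om)]. *)
Definition in_class (R : realType) (n r : nat) (G : graph_pair (n %/ r))
    (Mstar : 'M[R]_n) (Om : {set 'I_n * 'I_n}) : Prop :=
  [/\ psd Mstar /\ \rank Mstar = r,
      forall i j : 'I_(n %/ r), \rank (block Mstar i j) = r,
      Om = induced_measurements G &
      graph_connected (edge1 G) /\ ~ bipartite (edge1 G)].

Definition objective (R : realType) (n r : nat) (g : 'M[R]_n -> R)
    (Mstar : 'M[R]_n) (Om : {set 'I_n * 'I_n}) (X : 'M[R]_(n, r)) : R :=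
  g (mask Om (X *m X^T - Mstar)).

(* Meant for a finite-dimensional [V]: the second condition then says that the
   differential of [g] is itself differentiable, and the third that the second
   differential is continuous, both tested vector by vector. *)
Definition twice_continuously_differentiable (R : realType)
    (V : normedModType R) (g : V -> R) : Prop :=
  [/\ forall x, differentiable g x,
      forall u x, differentiable ('D_u g) x &
      forall u v, continuous ('D_v ('D_u g))].

Definition hessian (R : realType) (V : normedModType R) (g : V -> R) (x : V) :
    V -> V -> R :=
  fun u v => 'D_v ('D_u g) x.

Definition positive_definite (R : realType) (V : normedModType R)
    (B : V -> V -> R) : Prop :=
  forall u, u != 0 -> 0 < B u u.

Definition minimizer (R : realType) (T : Type) (g : T -> R) (x : T) : Prop :=
  forall y, g x <= g y.

Definition unique_minimizer (R : realType) (T : Type) (g : T -> R) (x : T) :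
    Prop :=
  minimizer g x /\ forall x', minimizer g x' -> x' = x.

Definition local_minimum (R : realType) (T : topologicalType) (f : T -> R)
    (x : T) : Prop :=
  \forall y \near x, f x <= f y.

(* The optimal value is an infimum in the extended reals, so it needs no
   boundedness assumption. *)
Definition spurious (R : realType) (T : topologicalType) (f : T -> R) (x : T) :
    Prop :=
  local_minimum f x /\ (ereal_inf [set (f y)%:E | y in [set: T]] < (f x)%:E)%E.

Definition equivalent (R : realType) (n r : nat) (X X' : 'M[R]_(n, r)) : Prop :=
  exists Q : 'M[R]_r, Q *m Q^T = 1%:M /\ X' = X *m Q.

Definition spurious_classes (R : realType) (n r : nat)
    (f : 'M[R]_(n, r) -> R) : set (set 'M[R]_(n, r)) :=
  [set [set X' | equivalent X X'] | X in [set X | spurious f X]].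

(* Main.v *)
(* Take [Mstar = Z_t *m Z_t^T], where the blocks of [Z_t] indexed by [S] are
   identities, the other blocks are [t%:M], and the trailing rows vanish.
   At [t = 0] the observations force, for any exact completion [X], the blocks
   in [S] to be orthogonal (self-loops), the other blocks to vanish (maximality
   of [S]) and the products [X_i *m X_i0^T] to be diagonal sign matrices
   (connectedness of [G_2[S]]); conversely every sign pattern occurs, because
   the diagonals of the blocks between distinct nodes of [S] are not observed,
   [S] being independent in [G_1] and joined only by [G_2].  Up to rotation these
   minimizers are isolated, so by compactness each of them survives as a local
   minimum for small [t].  For [t != 0] connectedness of [G_1] makes the
   completion unique, so all sign patterns but one become spurious.  *)

Require Import Defs.
From HB Require Import structures.
From mathcomp Require Import all_boot all_order all_algebra.
From mathcomp Require Import all_classical all_reals all_analysis.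
From mathcomp Require Import ring lra.

Set Implicit Arguments.
Unset Strict Implicit.
Unset Printing Implicit Defensive.

Import Order.TTheory GRing.Theory Num.Theory.
Import numFieldNormedType.Exports.

Local Open Scope classical_set_scope.
Local Open Scope ring_scope.
Local Open Scope card_scope.

(** * Entrywise limits and compact boxes of matrices *)

Lemma cvg_mx (T : topologicalType) (m n : nat) (I : Type) (F : set_system I)
    (f : I -> 'M[T]_(m, n)) (M : 'M[T]_(m, n)) :
  Filter F -> (forall i j, f x i j @[x --> F] --> M i j) -> f @ F --> M.
Proof.
move=> FF fM A [P MP PA].
have : \forall x \near F, forall i j, P i j (f x i j).
  by apply: filter_forall => i; apply: filter_forall => j; exact/fM/MP.
by apply: filterS => x ?; exact: PA.
Qed.

Lemma cvg_coord (R : realType) (m n : nat) (I : Type) (F : set_system I)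
    (f : I -> 'M[R]_(m, n)) (A : 'M[R]_(m, n)) i j :
  Filter F -> f @ F --> A -> f x i j @[x --> F] --> A i j.
Proof.
move=> FF fA; apply: (@continuous_cvg _ _ _ _ _ f (fun M => M i j)) => //.
exact: coord_continuous.
Qed.

Lemma cvg_mulmx (R : realType) (m n p : nat) (I : Type) (F : set_system I)
    (f : I -> 'M[R]_(m, n)) (g : I -> 'M[R]_(n, p)) (A : 'M[R]_(m, n))
    (B : 'M[R]_(n, p)) :
  Filter F -> f @ F --> A -> g @ F --> B -> f x *m g x @[x --> F] --> A *m B.
Proof.
move=> FF fA gB; apply: cvg_mx => i j; rewrite !mxE.
under eq_fun do rewrite mxE.
apply: cvg_big => [x|k _]; first exact: add_continuous.
by apply: cvgM; exact: cvg_coord.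
Qed.

Lemma cvg_trmx (R : realType) (m n : nat) (I : Type) (F : set_system I)
    (f : I -> 'M[R]_(m, n)) (A : 'M[R]_(m, n)) :
  Filter F -> f @ F --> A -> (f x)^T @[x --> F] --> A^T.
Proof.
move=> FF fA; apply: cvg_mx => i j; rewrite mxE.
under eq_fun do rewrite mxE.
exact: cvg_coord.
Qed.

(* Unqualified [mask] is the sequence function of MathComp. *)
Lemma cvg_mask (R : realType) (n : nat) (Om : {set 'I_n * 'I_n}) (I : Type)
    (F : set_system I) (f : I -> 'M[R]_n) (A : 'M[R]_n) :
  Filter F -> f @ F --> A -> Defs.mask Om (f x) @[x --> F] --> Defs.mask Om A.
Proof.
move=> FF fA; apply: cvg_mx => i j; rewrite mxE.
under eq_fun do rewrite mxE.
case: ifP => _; last exact: cvg_cst.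
exact: cvg_coord.
Qed.

(** Boxes of row vectors are compact as products of segments, and the continuous map [vec_mx]
    carries them onto boxes of matrices. *)
Lemma compact_mx_box (R : realType) (m n : nat) (B : R) :
  compact [set X : 'M[R]_(m, n) | forall i j, - B <= X i j <= B].
Proof.
have boxE : [set X : 'M[R]_(m, n) | forall i j, - B <= X i j <= B] =
    vec_mx @` [set v : 'rV[R]_(m * n) | forall k, `[- B, B]%classic (v ord0 k)].
  apply/seteqP; split=> [X XB|_ [v vB <-] i j]; last first.
    by rewrite mxE; have := vB (mxvec_index i j); rewrite /= in_itv.
  exists (mxvec X); last exact: mxvecK.
  by move=> k /=; case/mxvec_indexP: k => i j; rewrite mxvecE in_itv; exact: XB.
rewrite boxE; apply: continuous_compact; last first.
  apply: (@rV_compact _ _ (fun=> `[- B, B]%classic)) => _.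
  exact: segment_compact.
apply: continuous_subspaceT => v; apply: (@cvg_mx _ _ _ _ (nbhs v)) => i j.
rewrite mxE.
under eq_fun do rewrite mxE.
exact: coord_continuous.
Qed.

(** * Persistence of local minima under a parameter, and a cardinality bound *)

Lemma closed_forall_ge (R : realType) (T : topologicalType) (J : Type)
    (D : set J) (a : R) (f : J -> T -> R) :
  (forall j, continuous (f j)) ->
  closed [set x | forall j, D j -> a <= f j x].
Proof.
move=> fc.
have -> : [set x | forall j, D j -> a <= f j x] =
    \bigcap_(j in D) (f j @^-1` [set y | a <= y]) by [].
apply: closed_bigI => j _; apply: preimage_closed; last exact: closed_ge.
by move=> x _; exact: fc.
Qed.

(** On the boundary of [K], [F t0] strictly exceeds its value at [x0], and compactness keeps this
    inequality for all [t] near [t0]. A minimizer of [F t] over [K] then avoids the boundary, so it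
    is a local minimum in the whole space. *)
Lemma local_minimum_persist (R : realType) (P T : topologicalType)
    (F : P -> T -> R) (K : set T) (t0 : P) (x0 : T) :
  continuous (fun p : P * T => F p.1 p.2) -> compact K -> closed K -> K x0 ->
  (forall x, K x -> F t0 x <= F t0 x0 -> nbhs x K) ->
  \forall t \near t0, exists2 x, K x & local_minimum (F t) x.
Proof.
move=> Fc Kc Kcl Kx0 Kmin.
have Ftc t : continuous (F t).
  move=> x; apply: (@continuous_comp _ _ _ (pair t) (fun p => F p.1 p.2)).
    by apply: cvg_pair; [exact: cvg_cst|exact: cvg_id].
  exact: Fc.
have Cc : compact (K `&` ~` K°).
  by apply: compact_closedI => //; apply: open_closedC; exact: open_interior.
(* Compactness replaces the neighbourhoods of [t0] that depend on the boundary point by a single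
   one. *)
have /compact_near_coveringP CP := Cc.
have Cgt : \forall t \near t0, K `&` ~` K° `<=` [set x | F t x0 < F t x].
  apply: CP => x [Kx nKx].
  have Fx : F t0 x0 < F t0 x.
    by rewrite ltNge; apply/negP => /(Kmin _ Kx).
  have cF : (F p.2 x0 - F p.2 p.1) @[p --> (x, t0)] --> F t0 x0 - F t0 x.
    apply: cvgB.
      apply: (@continuous_cvg _ _ _ _ _ (fun p : T * P => (p.2, x0))
         (fun p => F p.1 p.2) (t0, x0)); first exact: Fc.
      by apply: cvg_pair; [exact: cvg_snd|exact: cvg_cst].
    apply: (@continuous_cvg _ _ _ _ _ (fun p : T * P => (p.2, p.1))
       (fun p => F p.1 p.2) (t0, x)); first exact: Fc.
    by apply: cvg_pair; [exact: cvg_snd|exact: cvg_fst].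
  have : \forall p \near (x, t0), F p.2 x0 - F p.2 p.1 < 0.
    by apply: (cvgr_lt _ cF); rewrite subr_lt0.
  by apply: filterS => p /=; rewrite subr_lt0.
apply: filterS Cgt => t Cgt.
have [|c] := @compact_EVT_min _ _ (F t) _ _ Kc (continuous_subspaceT (Ftc t)).
  by exists x0.
rewrite inE => Kc' cmin; exists c => //.
have /filterS : nbhs c K; last first.
  by apply=> y Ky; apply: cmin; rewrite inE.
(* On the boundary, [c] would have a larger value than [x0], which also lies in [K]. *)
apply: contrapT => nKc; have /= := Cgt c (conj Kc' nKc).
by rewrite ltNge cmin// inE.
Qed.

Lemma card_le_finset (T : finType) (D : {set T}) (U : Type) (B : set U)
    (f : T -> U) :
  (forall x, x \in D -> B (f x)) -> {in D &, injective f} -> `I_#|D| #<= B.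
Proof.
move=> fB finj.
(* The enumeration by [nth] needs a default element, so an empty [D] is treated apart. *)
have [->|[x0 x0D]] := set_0Vmem D.
  by rewrite cards0 II0; exact: card_ge0.
have hf k : `I_#|D| k -> nth x0 (enum D) k \in D.
  by move=> /= kD; rewrite -mem_enum mem_nth// -cardE.
have : $|{injfun `I_#|D| >-> B}|.
  apply/injfunPex; exists (fun k => f (nth x0 (enum D) k)).
    by move=> k /hf; exact: fB.
  move=> i j /[!inE] iD jD /finj; rewrite !hf// => /(_ isT isT) /eqP.
  by rewrite nth_uniq -?cardE ?enum_uniq// => /eqP.
by move=> [h]; exact: inj_card_le h.
Qed.

(** * Block indices and factors with diagonal blocks *)

Lemma block_index_inj (n r : nat) (i j : 'I_(n %/ r)) (a b : 'I_r) :
  block_index i a = block_index j b -> i = j /\ a = b.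
Proof.
have r0 : (0 < r)%N by apply: leq_trans (ltn_ord a).
move=> /(congr1 val) /= e; split; apply/val_inj => /=.
  by move/(congr1 (divn^~ r)): e;
    rewrite !divnMDl// !(divn_small (ltn_ord _)) !addn0.
by move/(congr1 (modn^~ r)): e; rewrite !modnMDl !(modn_small (ltn_ord _)).
Qed.

Variant index_spec (n r : nat) : 'I_n -> Prop :=
| IndexBlock (i : 'I_(n %/ r)) (a : 'I_r) : index_spec r (block_index i a)
| IndexTail (p : 'I_n) : (n %/ r * r <= p)%N -> index_spec r p.

Lemma indexP (n r : nat) (p : 'I_n) : (0 < r)%N -> index_spec r p.
Proof.
move=> r0; have [|pm] := leqP (n %/ r * r) p; first exact: IndexTail.
have ltd : (p %/ r < n %/ r)%N by rewrite ltn_divLR.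
have ltm : (p %% r < r)%N by rewrite ltn_mod.
suff -> : p = block_index (Ordinal ltd) (Ordinal ltm) by constructor.
by apply/val_inj; rewrite /= -divn_eq.
Qed.

Definition block_rows (R : Type) (n r : nat) (X : 'M[R]_(n, r))
  (i : 'I_(n %/ r)) : 'M[R]_r := rowsub (@block_index n r i) X.

Lemma block_mulmx_tr (R : realType) (n r : nat) (X Y : 'M[R]_(n, r)) i j :
  block (X *m Y^T) i j = block_rows X i *m (block_rows Y j)^T.
Proof.
apply/matrixP => a b; rewrite !mxE.
by apply: eq_bigr => k _; rewrite !mxE.
Qed.

(** Block [i] is the diagonal matrix with entries [c i]. The sum has at most one term and is empty
    on trailing rows, so no case analysis on [p] is needed. *)
Definition stack (R : realType) (n r : nat) (c : 'I_(n %/ r) -> 'I_r -> R) :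
    'M[R]_(n, r) :=
  \matrix_(p, b) \sum_(i | p == block_index i b) c i b.

Lemma block_rows_stack (R : realType) (n r : nat)
    (c : 'I_(n %/ r) -> 'I_r -> R) j :
  block_rows (stack c) j = diag_mx (\row_a c j a).
Proof.
apply/matrixP => a b; rewrite !mxE; case: eqVneq => [->|ab].
  rewrite (big_pred1 j) ?mulr1n// => i /=.
  by apply/eqP/eqP => [/block_index_inj[]|->].
rewrite big_pred0 ?mulr0n// => i.
by apply/negbTE; apply: contra ab => /eqP/block_index_inj[_ ->].
Qed.

Lemma stack_tail (R : realType) (n r : nat) (c : 'I_(n %/ r) -> 'I_r -> R)
    (p : 'I_n) b :
  (n %/ r * r <= p)%N -> stack c p b = 0.
Proof.
move=> ptail; rewrite mxE big_pred0// => i; apply/negbTE/eqP => pE.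
have := block_index_subproof i b; move: ptail; rewrite pE /=.
have : (i * r + b < n %/ r * r)%N.
  apply: (@leq_trans (i.+1 * r)); first by rewrite mulSn addnC ltn_add2r.
  by rewrite leq_mul2r ltn_ord orbT.
by rewrite ltnNge => /negP.
Qed.

Lemma cvg_stack (R : realType) (n r : nat) (I : Type) (F : set_system I)
    (c : I -> 'I_(n %/ r) -> 'I_r -> R) (l : 'I_(n %/ r) -> 'I_r -> R) :
  Filter F -> (forall i a, c x i a @[x --> F] --> l i a) ->
  stack (c x) @[x --> F] --> stack l.
Proof.
move=> FF cl; apply: cvg_mx => p b; rewrite mxE.
under eq_fun do rewrite mxE.
by apply: cvg_big => [x|i _]; [exact: add_continuous|exact: cl].
Qed.

Lemma induced_measurements_tail (n r : nat) (G : graph_pair (n %/ r))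
    (p q : 'I_n) :
  (n %/ r * r <= p)%N -> (p, q) \in induced_measurements G.
Proof. by move=> pt; rewrite inE pt. Qed.

Lemma induced_measurements_block (n r : nat) (G : graph_pair (n %/ r))
    (i j : 'I_(n %/ r)) (a b : 'I_r) :
  edge1 G i j || edge2 G i j && (a != b) ->
  (block_index i a, block_index j b) \in induced_measurements G.
Proof.
move=> ij; rewrite inE; apply/or3P/Or33/existsP; exists i; apply/existsP.
by exists j; apply/existsP; exists a; apply/existsP; exists b; rewrite eqxx.
Qed.

Lemma mask_sub_eq0 (R : realType) (n : nat) (Om : {set 'I_n * 'I_n})
    (A B : 'M[R]_n) :
  Defs.mask Om (A - B) = 0 <-> forall p q, (p, q) \in Om -> A p q = B p q.
Proof.
split=> [/matrixP e p q pq|e].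
  by move: (e p q); rewrite !mxE pq => /eqP; rewrite subr_eq0 => /eqP.
apply/matrixP => p q; rewrite !mxE; case: ifP => // pq.
by rewrite e// subrr.
Qed.

(** * What agreement on the observed entries forces on a factor *)

Section Completions.
Variables (R : realType) (n r : nat) (G : graph_pair (n %/ r)).
Variables (X Z : 'M[R]_(n, r)).
Hypothesis XZ :
  Defs.mask (induced_measurements G) (X *m X^T - Z *m Z^T) = 0.

Lemma completion_edge1 i j : edge1 G i j ->
  block_rows X i *m (block_rows X j)^T = block_rows Z i *m (block_rows Z j)^T.
Proof.
move=> ij; rewrite -!block_mulmx_tr; apply/matrixP => a b; rewrite !mxE.
have /mask_sub_eq0/(_ (block_index i a) (block_index j b)) := XZ.
by rewrite !mxE; apply; apply: induced_measurements_block; rewrite ij.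
Qed.

Lemma completion_edge2 i j a b : edge2 G i j -> a != b ->
  (block_rows X i *m (block_rows X j)^T) a b =
  (block_rows Z i *m (block_rows Z j)^T) a b.
Proof.
move=> ij ab; rewrite -!block_mulmx_tr !mxE.
have /mask_sub_eq0/(_ (block_index i a) (block_index j b)) := XZ.
by rewrite !mxE; apply; apply: induced_measurements_block; rewrite ij ab orbT.
Qed.

Lemma completion_tail (p : 'I_n) i : (n %/ r * r <= p)%N ->
  row p X *m (block_rows X i)^T = row p Z *m (block_rows Z i)^T.
Proof.
have entryE (U : 'M[R]_(n, r)) a :
    (row p U *m (block_rows U i)^T) 0 a = (U *m U^T) p (block_index i a).
  by rewrite !mxE; apply: eq_bigr => k _; rewrite !mxE.
move=> pt; apply/rowP => a; rewrite !entryE.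
have /mask_sub_eq0 := XZ; apply; exact: induced_measurements_tail.
Qed.

(** After division by the weights, each edge of [edge1 G] reads [Y i *m (Y j)^T = 1%:M]. The loop
    makes [Y i0] orthogonal, so a neighbour of a node with block [Y i0] has the same block;
    connectedness spreads this to every node. *)
Lemma completion_unique (w : 'I_(n %/ r) -> R) (i0 : 'I_(n %/ r)) :
  graph_connected (edge1 G) -> edge1 G i0 i0 ->
  (forall i, w i != 0) -> (forall i, block_rows Z i = (w i)%:M) ->
  forall i, block_rows X i *m (block_rows X i0)^T =
            block_rows Z i *m (block_rows Z i0)^T.
Proof.
move=> Gconn loop0 w0 Zw.
pose Y i := (w i)^-1 *: block_rows X i.
have Yedge i j : edge1 G i j -> Y i *m (Y j)^T = 1%:M.
  move=> /completion_edge1 e; rewrite /Y linearZ /= -scalemxAl -scalemxAr e !Zw.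
  rewrite tr_scalar_mx -scalar_mxM !scale_scalar_mx; congr (_%:M).
  by field; rewrite !w0.
have Y00 := Yedge _ _ loop0; have Y0u := mulmx1C Y00.
have Yconst i : Y i = Y i0.
  have /forallP/(_ i0)/forallP/(_ i) := Gconn.
  move=> /connectP[s]; elim/last_ind: s i => [i _ -> //|s j IHs i].
  rewrite rcons_path last_rcons => /andP[ps sj] ->.
  have := Yedge _ _ sj; rewrite (IHs _ ps erefl) => e.
  by rewrite -[LHS]trmxK -[(Y j)^T]mul1mx -Y0u -mulmxA e mulmx1 trmxK.
move=> i; have XY k : block_rows X k = w k *: Y k.
  by rewrite scalerA mulfV ?scale1r.
rewrite !XY !Yconst [(w i0 *: _)^T]linearZ /= -scalemxAl -scalemxAr Y00 !Zw.
by rewrite tr_scalar_mx -scalar_mxM !scale_scalar_mx mulr1.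
Qed.

(** Serves at [t = 0]: the two conclusions place each exact completion lying in a [flip_box] in the
    interior of that box. *)
Lemma completion_rigid (S : {set 'I_(n %/ r)}) (i0 : 'I_(n %/ r)) :
  (0 < r)%N -> maximal_independent (edge1 G) S ->
  (forall i, i \in S -> edge1 G i i) -> induced_connected (edge2 G) S ->
  i0 \in S ->
  (forall i, block_rows Z i = (i \in S)%:R%:M) ->
  (forall (p : 'I_n) b, (n %/ r * r <= p)%N -> Z p b = 0) ->
  (forall p b, `|X p b| <= 1) /\
  (forall i a, i \in S ->
    (block_rows X i *m (block_rows X i0)^T) a a ^+ 2 = 1).
Proof.
move=> r0 Smax Sloop Sconn i0S ZS Ztail.
have Sind : independent (edge1 G) S by case/maxsetP: Smax.
have XS i : i \in S -> block_rows X i *m (block_rows X i)^T = 1%:M.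
  move=> iS; rewrite completion_edge1 ?Sloop// !ZS iS.
  by rewrite tr_scalar_mx -scalar_mxM mulr1.
(* Otherwise [k] could be added to [S], against maximality. *)
have dominated k : k \notin S -> exists2 i, i \in S & edge1 G k i.
  move=> kS; apply: contrapT => nodom.
  have ndom i : i \in S -> ~~ edge1 G k i.
    by move=> iS; apply/negP => ki; apply: nodom; exists i.
  have : k |: S = S.
    case/maxsetP: Smax => _; apply; last exact: finset.subsetUr.
    apply/forall_inP => i /setU1P[->|iS]; apply/forall_inP => j /setU1P[->|jS];
      apply/implyP => // ij.
    - by rewrite eqxx in ij.
    - exact: ndom.
    - by rewrite edge1_sym ndom.
    - by have /forall_inP/(_ _ iS)/forall_inP/(_ _ jS) := Sind; rewrite ij.
  by move=> kSE; rewrite -kSE setU11 in kS.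
have XnS k : k \notin S -> block_rows X k = 0.
  (* The edge gives [X_k *m X_i^T = 0], and [X_i] is invertible. *)
  move=> kS; have [i iS /completion_edge1] := dominated k kS.
  rewrite !ZS (negbTE kS) mul_scalar_mx scale0r => e.
  by rewrite -[LHS]mulmx1 -(mulmx1C (XS i iS)) mulmxA e mul0mx.
have Xtail (p : 'I_n) : (n %/ r * r <= p)%N -> row p X = 0.
  move=> pt; have Zp : row p Z = 0 by apply/rowP => b; rewrite !mxE Ztail.
  have := completion_tail i0 pt; rewrite Zp mul0mx => e.
  by rewrite -[LHS]mulmx1 -(mulmx1C (XS i0 i0S)) mulmxA e mul0mx.
split.
  move=> p b; case: (indexP p r0) => [i a|{}p pt]; last first.
    by have /rowP/(_ b) := Xtail _ pt; rewrite !mxE => ->; rewrite normr0.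
  have [iS|/XnS/matrixP/(_ a b)] := boolP (i \in S); last first.
    by rewrite !mxE => ->; rewrite normr0.
  (* A row of an orthogonal matrix has squared norm 1, which bounds each squared entry. *)
  have /matrixP/(_ a a) := XS i iS; rewrite !mxE eqxx mulr1n.
  under eq_bigr do rewrite !mxE -expr2.
  move=> e; rewrite -(@expr_le1 _ 2)// real_normK ?num_real// -e (bigD1 b)//=.
  by rewrite lerDl sumr_ge0// => k _; rewrite sqr_ge0.
pose P i := block_rows X i *m (block_rows X i0)^T.
have P_orth i : i \in S -> P i *m (P i)^T = 1%:M.
  move=> iS; rewrite /P trmx_mul trmxK mulmxA -(mulmxA (block_rows X i)).
  by rewrite (mulmx1C (XS i0 i0S)) mulmx1 XS.
(* For a diagonal [P i], orthogonality says that each diagonal entry squares to 1. *)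
suff P_diag i : i \in S -> is_diag_mx (P i).
  move=> i a iS; rewrite -/(P i); have /matrixP/(_ a a) := P_orth i iS.
  rewrite [X in X = _ -> _]mxE [X in _ = X -> _]mxE eqxx (bigD1 a)//= big1.
    by rewrite addr0 [X in _ * X]mxE -expr2.
  by move=> b ba; have /is_diag_mxP -> := P_diag i iS; rewrite ?mul0r// eq_sym.
move=> iS; have /forall_inP/(_ _ i0S)/forall_inP/(_ _ iS) := Sconn.
move=> /connectP[s]; elim/last_ind: s i iS => [i _ _ ->|s j IHs i iS].
  by rewrite /P XS// scalar_mx_is_diag.
rewrite rcons_path last_rcons => /andP[ps].
set k := last _ _ => /and3P[kS jS kj] ->.
have Pk : is_diag_mx (P k) by apply: IHs.
(* Inserting [X_k^T *m X_k = 1] splits off [P k], diagonal by induction. The other factor has zero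
   off-diagonal entries, as these are observed on an edge of [edge2 G]. *)
have -> : P j = (block_rows X j *m (block_rows X k)^T) *m P k.
  by rewrite /P mulmxA -(mulmxA (block_rows X j)) (mulmx1C (XS k kS)) mulmx1.
have /diag_mxP[d ->] := Pk.
apply/is_diag_mxP => a b ab; have abE : (a == b) = false by exact/negbTE.
rewrite mul_mx_diag mxE completion_edge2//.
  by rewrite !ZS kS jS tr_scalar_mx -scalar_mxM mxE abE mulr0n mul0r.
by rewrite edge2_sym.
Qed.

End Completions.

(** * Gram matrices of sign patterns and membership in the class *)

Lemma gram_block (R : realType) (n r : nat) (X : 'M[R]_(n, r)) i j a b :
  (X *m X^T) (block_index i a) (block_index j b) =
  (block_rows X i *m (block_rows X j)^T) a b.
Proof. by rewrite -block_mulmx_tr [RHS]mxE. Qed.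

Lemma gram_stack_block (R : realType) (n r : nat)
    (c : 'I_(n %/ r) -> 'I_r -> R) i j a b :
  (stack c *m (stack c)^T) (block_index i a) (block_index j b) =
  (c i a * c j a) *+ (a == b).
Proof.
by rewrite gram_block !block_rows_stack tr_diag_mx mulmx_diag !mxE.
Qed.

Lemma gram_stack_tail (R : realType) (n r : nat)
    (c : 'I_(n %/ r) -> 'I_r -> R) (p q : 'I_n) :
  (n %/ r * r <= p)%N || (n %/ r * r <= q)%N ->
  (stack c *m (stack c)^T) p q = 0.
Proof.
move=> /orP[] t; rewrite mxE big1// => k _; rewrite [X in _ * X]mxE.
  by rewrite (stack_tail c _ t) mul0r.
by rewrite (stack_tail c _ t) mulr0.
Qed.

(** Signs are invisible to the measurements: off-diagonal entries of blocks vanish, diagonal blocks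
    only show squares, and a fully observed block between distinct nodes has a node outside [S],
    where the coefficients are zero. *)
Lemma mask_stack_sub_eq0 (R : realType) (n r : nat) (G : graph_pair (n %/ r))
    (S : {set 'I_(n %/ r)}) (c d : 'I_(n %/ r) -> 'I_r -> R) :
  independent (edge1 G) S ->
  (forall i a, c i a ^+ 2 = (i \in S)%:R) ->
  (forall i a, d i a ^+ 2 = (i \in S)%:R) ->
  Defs.mask (induced_measurements G)
    (stack c *m (stack c)^T - stack d *m (stack d)^T) = 0.
Proof.
move=> Sind c2 d2; apply/mask_sub_eq0 => p q.
rewrite inE orbA => /orP[t|]; first by rewrite !gram_stack_tail.
move=> /existsP[i] /existsP[j] /existsP[a] /existsP[b] /andP[/eqP[-> ->]].
rewrite !gram_stack_block => /orP[ij|/andP[_ /negbTE->]]; last first.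
  by rewrite !mulr0n.
suff prodE (e : 'I_(n %/ r) -> 'I_r -> R) :
    (forall i a, e i a ^+ 2 = (i \in S)%:R) ->
    e i a * e j a = ((i == j) && (i \in S))%:R by rewrite !prodE.
move=> e2; have [<-|nij] := eqVneq i j; first by rewrite -expr2 e2.
have e0 k : k \notin S -> e k a = 0.
  by move=> kS; apply/eqP; rewrite -sqrf_eq0 e2 (negbTE kS).
have [iS|/e0->] := boolP (i \in S); last by rewrite mul0r.
have [jS|/e0->] := boolP (j \in S); last by rewrite mulr0.
by have /forall_inP/(_ _ iS)/forall_inP/(_ _ jS) := Sind; rewrite nij ij.
Qed.

Lemma psd_gram (R : realType) (n r : nat) (Z : 'M[R]_(n, r)) : psd (Z *m Z^T).
Proof.
split=> [|v]; first by rewrite trmx_mul trmxK.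
rewrite mulmxA -mulmxA -trmx_mul mxE sumr_ge0// => k _.
by rewrite [X in _ * X]mxE -expr2 sqr_ge0.
Qed.

Lemma rank_block_le (R : realType) (n r : nat) (M : 'M[R]_n) i j :
  (\rank (@block R n r M i j) <= \rank M)%N.
Proof.
have -> : block M i j =
    (rowsub (@block_index n r j) (rowsub (@block_index n r i) M)^T)^T.
  by apply/matrixP => a b; rewrite !mxE.
rewrite mxrank_tr (leq_trans (mxrankS (rowsub_sub _ _)))// mxrank_tr.
exact/mxrankS/rowsub_sub.
Qed.

(** Block [(i, j)] is the scalar matrix [w i * w j], hence invertible. The total rank is at least
    that of one block and at most the number [r] of columns of [Z]. *)
Lemma gram_in_class (R : realType) (n r : nat) (G : graph_pair (n %/ r))
    (Z : 'M[R]_(n, r)) (w : 'I_(n %/ r) -> R) :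
  (0 < n %/ r)%N -> graph_connected (edge1 G) -> ~ bipartite (edge1 G) ->
  (forall i, w i != 0) -> (forall i, block_rows Z i = (w i)%:M) ->
  in_class G (Z *m Z^T) (induced_measurements G).
Proof.
move=> m0 Gconn Gnonbip w0 Zw.
have rk (i j : 'I_(n %/ r)) : \rank (block (Z *m Z^T) i j) = r.
  rewrite block_mulmx_tr !Zw tr_scalar_mx -scalar_mxM -scalemx1.
  by rewrite mxrank_scale_nz ?mulf_neq0// mxrank1.
split=> //; split; first exact: psd_gram.
apply/eqP; rewrite eqn_leq (leq_trans (mxrankM_maxl _ _)) ?rank_leq_col//=.
by rewrite -{1}(rk (Ordinal m0) (Ordinal m0)) rank_block_le.
Qed.

(** Singletons are independent even with a self-loop, so the empty set is not maximal. *)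
Lemma maximal_independent_neq0 (m : nat) (e : rel 'I_m) (S : {set 'I_m}) :
  (0 < m)%N -> maximal_independent e S -> exists i, i \in S.
Proof.
move=> m0 /maxsetP[_ Smax]; have [S0|[i iS]] := set_0Vmem S; last by exists i.
exists (Ordinal m0); rewrite -(Smax [set Ordinal m0]%SET) ?set11//.
  apply/forall_inP => i /set1P->; apply/forall_inP => j /set1P->.
  by rewrite eqxx.
by rewrite S0 finset.sub0set.
Qed.

(** * Rotation invariance and boxes of sign patterns *)

(** The Gram matrix is the invariant that tells equivalence classes apart. *)
Lemma equivalent_gram (R : realType) (n r : nat) (X X' : 'M[R]_(n, r)) :
  equivalent X X' -> X' *m X'^T = X *m X^T.
Proof.
by move=> [Q [QQ ->]]; rewrite trmx_mul mulmxA -(mulmxA X) QQ mulmx1.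
Qed.

Lemma equivalent_refl (R : realType) (n r : nat) (X : 'M[R]_(n, r)) :
  equivalent X X.
Proof. by exists 1%:M; rewrite trmx1 !mulmx1. Qed.

Definition flip (R : realType) (m r : nat) (A : {set 'I_m * 'I_r})
  (i : 'I_m) (a : 'I_r) : R := (-1) ^+ ((i, a) \in A).

(* On the minimizers for [t = 0] the tested products are exactly [1] and the
   entries are at most [1] in absolute value, so these minimizers lie in the
   interior; boxes of different [A] are disjoint even after rotating [X]. *)
Definition flip_box (R : realType) (n r : nat) (S : {set 'I_(n %/ r)})
    (i0 : 'I_(n %/ r)) (A : {set 'I_(n %/ r) * 'I_r}) : set 'M[R]_(n, r) :=
  [set X : 'M[R]_(n, r) | (forall p b, - 2 <= X p b <= 2) /\
    forall k : 'I_(n %/ r) * 'I_r, k.1 \in S ->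
      2^-1 <= flip R A k.1 k.2 *
        (X *m X^T) (block_index k.1 k.2) (block_index i0 k.2)].

Lemma cvg_gram (R : realType) (n r : nat) (X : 'M[R]_(n, r)) (s : R) p q :
  s * (Y *m Y^T) p q @[Y --> X] --> s * (X *m X^T) p q.
Proof.
have cX : Y *m Y^T @[Y --> X] --> X *m X^T.
  by apply: (@cvg_mulmx _ _ _ _ _ (nbhs X) id trmx) => //; exact: cvg_trmx.
by apply: (@cvgM _ _ (nbhs X)); [exact: cvg_cst|exact: cvg_coord].
Qed.

Lemma flip_box_compact (R : realType) (n r : nat) (S : {set 'I_(n %/ r)}) i0 A :
  compact (@flip_box R n r S i0 A) /\ closed (@flip_box R n r S i0 A).
Proof.
have cbox := @compact_mx_box R n r 2.
have cgram : closed [set X : 'M[R]_(n, r) |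
    forall k : 'I_(n %/ r) * 'I_r, k.1 \in S ->
      2^-1 <= flip R A k.1 k.2 *
        (X *m X^T) (block_index k.1 k.2) (block_index i0 k.2)].
  apply: (@closed_forall_ge R _ _ [set k | k.1 \in S]) => k X.
  exact: cvg_gram.
have c : compact (@flip_box R n r S i0 A) by exact: compact_closedI cbox cgram.
by split=> //; apply: compact_closed => //; exact: norm_hausdorff.
Qed.

Lemma flip_box_nbhs (R : realType) (n r : nat) (S : {set 'I_(n %/ r)}) i0 A
    (X : 'M[R]_(n, r)) :
  (forall p b, `|X p b| <= 1) ->
  (forall i a, i \in S ->
    (X *m X^T) (block_index i a) (block_index i0 a) ^+ 2 = 1) ->
  flip_box S i0 A X -> nbhs X (flip_box S i0 A).
Proof.
move=> X1 Xgram [_ Xflip]; rewrite /flip_box.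
apply: (@filterI _ (nbhs X) _).
  apply: (@filter_forall _ _ _ (nbhs X)) => p.
  apply: (@filter_forall _ _ _ (nbhs X)) => b.
  have /andP[Xl Xu] : - 1 <= X p b <= 1 by rewrite -ler_norml.
  have cX : Y p b @[Y --> X] --> X p b by exact: coord_continuous.
  near=> Y; apply/andP; split; apply/ltW; near: Y.
    by apply: (cvgr_gt _ cX); lra.
  by apply: (cvgr_lt _ cX); lra.
apply: (@filter_forall _ _ _ (nbhs X)) => k.
have [kS|_] := boolP (k.1 \in S); last exact: nearW.
have := Xflip k kS; have := Xgram k.1 k.2 kS.
have := @cvg_gram R n r X (flip R A k.1 k.2)
  (block_index k.1 k.2) (block_index i0 k.2).
set v := (X *m X^T) _ _ => cv v2 vge.
have fv : (flip R A k.1 k.2 * v) ^+ 2 = 1.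
  by rewrite exprMn v2 mulr1 /flip sqrr_sign.
(* The signed product squares to 1 and is at least 1/2, so it is 1 and satisfies the test
   strictly. *)
near=> Y => _; apply/ltW; near: Y.
by apply: (cvgr_gt _ cv); nra.
Unshelve. all: by end_near. Qed.

(** At a position where [A] and [B] differ, one Gram entry would be both at least 1/2 and at most
    -1/2. *)
Lemma flip_box_inj (R : realType) (n r : nat) (S : {set 'I_(n %/ r)}) i0
    (A B : {set 'I_(n %/ r) * 'I_r}) (X Y : 'M[R]_(n, r)) :
  {in A, forall k, k.1 \in S} -> {in B, forall k, k.1 \in S} ->
  flip_box S i0 A X -> flip_box S i0 B Y -> X *m X^T = Y *m Y^T -> A = B.
Proof.
move=> AS BS [_ XA] [_ YB] XY; apply/setP => -[i a].
have [iS|iS] := boolP (i \in S); last first.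
  by apply/idP/idP => [/AS|/BS] /=; rewrite (negbTE iS).
have := XA (i, a) iS; have := YB (i, a) iS; rewrite /flip /= XY.
by case: (_ \in A); case: (_ \in B); rewrite ?expr1 ?expr0 => //; lra.
Qed.

(** * The perturbed family and its spurious local minima *)

Definition base_weight (R : realType) (m : nat) (S : {set 'I_m}) (t : R)
  (i : 'I_m) : R := if i \in S then 1 else t.

(** The factor [Z_t] of the ground truth. *)
Definition base (R : realType) (n r : nat) (S : {set 'I_(n %/ r)}) (t : R) :
  'M[R]_(n, r) := stack (fun i _ => base_weight S t i).

Lemma block_rows_base (R : realType) (n r : nat) (S : {set 'I_(n %/ r)}) (t : R)
    i :
  block_rows (@base R n r S t) i = (base_weight S t i)%:M.
Proof.
rewrite block_rows_stack -diag_const_mx; congr diag_mx.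
by apply/rowP => a; rewrite !mxE.
Qed.

Lemma base_objective_continuous (R : realType) (n r : nat)
    (S : {set 'I_(n %/ r)}) (g : 'M[R]_n -> R) (Om : {set 'I_n * 'I_n}) :
  continuous g ->
  continuous (fun p : R * 'M[R]_(n, r) =>
    objective g (base S p.1 *m (base S p.1)^T) Om p.2).
Proof.
move=> gc [t X].
have cX : p.2 @[p --> (t, X)] --> X by exact: cvg_snd.
have cZ : base S p.1 @[p --> (t, X)] --> (base S t : 'M[R]_(n, r)).
  apply: cvg_stack => i _; rewrite /base_weight.
  by case: ifP => _; [exact: cvg_cst|exact: cvg_fst].
apply: (@continuous_cvg _ _ _ _ _ (fun p : R * 'M[R]_(n, r) =>
  Defs.mask Om (p.2 *m p.2^T - base S p.1 *m (base S p.1)^T)) g).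
  exact: gc.
by apply: cvg_mask; apply: cvgB; apply: cvg_mulmx => //; exact: cvg_trmx.
Qed.

(** At [t = 0] the box contains an exact completion with sign pattern [A], and every minimizer in
    the box is an exact completion, hence interior by rigidity. The persistence lemma then
    applies. *)
Lemma flipped_local_minimum (R : realType) (n r : nat) (G : graph_pair (n %/ r))
    (S : {set 'I_(n %/ r)}) (i0 : 'I_(n %/ r)) (g : 'M[R]_n -> R)
    (A : {set 'I_(n %/ r) * 'I_r}) :
  (0 < r)%N -> maximal_independent (edge1 G) S ->
  (forall i, i \in S -> edge1 G i i) -> induced_connected (edge2 G) S ->
  i0 \in S -> continuous g -> unique_minimizer g 0 ->
  (forall a, (i0, a) \notin A) ->
  \forall t \near (0 : R), exists2 X, flip_box S i0 A X &
    local_minimum (objective g (base S t *m (base S t)^T)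
      (induced_measurements G)) X.
Proof.
move=> r0 Smax Sloop Sconn i0S gc [gmin gunique] A0.
set Om := induced_measurements G.
have [Kc Kcl] := @flip_box_compact R n r S i0 A.
pose x0 : 'M[R]_(n, r) :=
  stack (fun i a => if i \in S then flip R A i a else 0).
have flip_sqr i a : flip R A i a ^+ 2 = 1 by rewrite /flip sqrr_sign.
have x0sqr i a : (if i \in S then flip R A i a else 0) ^+ 2 = (i \in S)%:R.
  by case: ifP => _; rewrite ?flip_sqr// expr0n.
have obj_x0 : objective g (base S 0 *m (base S 0)^T) Om x0 = g 0.
  rewrite /objective (@mask_stack_sub_eq0 R n r G S)//.
    by case/maxsetP: Smax.
  by move=> i _; rewrite /base_weight; case: ifP; rewrite ?expr1n ?expr0n.
apply: (@local_minimum_persist R _ _ (fun t => objective g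
  (base S t *m (base S t)^T) Om) (flip_box S i0 A) 0 x0) => //.
- exact: base_objective_continuous.
- split=> [p b|[i a] /= iS].
    rewrite -ler_norml; case: (indexP p r0) => [i a|{}p pt]; last first.
      by rewrite stack_tail// normr0.
    have := block_rows_stack (fun i a => if i \in S then flip R A i a else 0) i.
    move=> /matrixP/(_ a b); rewrite !mxE => ->; rewrite /flip.
    case: (a == b); rewrite ?mulr0n ?normr0// mulr1n.
    by case: ifP => _; rewrite ?normrX ?normrN1 ?expr1n ?normr0 ?ler1n.
  (* The tested product reduces to the sign at [(i0, a)], which is 1 because [A] avoids [i0]. *)
  rewrite gram_stack_block eqxx iS i0S mulr1n mulrA -expr2 flip_sqr mul1r.
  by rewrite /flip (negbTE (A0 a)) expr0; lra.
- move=> X KX; rewrite obj_x0 => gX.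
  have XZ : Defs.mask Om (X *m X^T - base S 0 *m (base S 0)^T) = 0.
    by apply: gunique => y; apply: le_trans gX (gmin y).
  have [||X1 Xgram] := completion_rigid XZ r0 Smax Sloop Sconn i0S.
  + by move=> i; rewrite block_rows_base /base_weight; case: (i \in S).
  + by move=> p b; exact: stack_tail.
  by apply: flip_box_nbhs => // i a iS; rewrite gram_block Xgram.
Qed.

(** The optimal value [g 0] is attained at [base S t]. A point of the box with this value would be
    an exact completion, so by uniqueness its Gram entry at a position of [A] would be 1, whereas
    the box makes it negative. *)
Lemma flipped_spurious (R : realType) (n r : nat) (G : graph_pair (n %/ r))
    (S : {set 'I_(n %/ r)}) (i0 : 'I_(n %/ r)) (g : 'M[R]_n -> R)
    (A : {set 'I_(n %/ r) * 'I_r}) (t : R) (X : 'M[R]_(n, r)) :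
  graph_connected (edge1 G) -> edge1 G i0 i0 -> i0 \in S -> t != 0 ->
  unique_minimizer g 0 -> A != finset.set0 -> {in A, forall k, k.1 \in S} ->
  let f := objective g (base S t *m (base S t)^T) (induced_measurements G) in
  flip_box S i0 A X -> local_minimum f X -> spurious f X.
Proof.
move=> Gconn loop0 i0S t0 [gmin gunique] /set0Pn[[i a] iaA] AS f [_ KX] Xmin.
have w0 k : base_weight S t k != 0.
  by rewrite /base_weight; case: ifP => // _; exact: oner_neq0.
split=> //; apply: (@le_lt_trans _ _ (g 0)%:E).
  apply: ereal_inf_lbound => /=; exists (base S t) => //.
  rewrite /f /objective subrr; congr (g _)%:E.
  by apply/matrixP => p q; rewrite !mxE if_same.
rewrite lte_fin lt_neqAle gmin andbT; apply/eqP => gX.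
have XZ : Defs.mask (induced_measurements G)
    (X *m X^T - base S t *m (base S t)^T) = 0.
  by apply: gunique => y; rewrite -[g _]gX.
have iS := AS _ iaA; rewrite /= in iS.
have := KX (i, a) iS; rewrite /= gram_block.
rewrite (completion_unique XZ Gconn loop0 w0 (block_rows_base S t)).
rewrite !block_rows_base tr_scalar_mx -scalar_mxM /base_weight iS i0S mulr1.
by rewrite mxE eqxx mulr1n /flip iaA expr1; lra.
Qed.

Theorem theorem3 (R : realType) (n r : nat)
    (hr : (1 <= r)%N) (hn : (2 * r <= n)%N)
    (G : graph_pair (n %/ r))
    (hconn : graph_connected (edge1 G))
    (hnonbip : ~ bipartite (edge1 G))
    (S : {set 'I_(n %/ r)})
    (hS : maximal_independent (edge1 G) S)
    (hloop : forall i, i \in S -> edge1 G i i)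
    (hS2 : induced_connected (edge2 G) S)
    (g : 'M[R]_n -> R)
    (hC2 : twice_continuously_differentiable g)
    (hmin : unique_minimizer g 0)
    (hhess : positive_definite (hessian g 0)) :
  exists (Mstar : 'M[R]_n) (Om : {set 'I_n * 'I_n}),
    in_class G Mstar Om /\
    `I_(2 ^ (r * (#|S| - 1)) - 1)%N
      #<= spurious_classes (@objective R n r g Mstar Om).
Proof.
have m0 : (0 < n %/ r)%N.
  by rewrite divn_gt0// (leq_trans _ hn)// leq_pmull.
have gc : continuous g.
  by move=> x; apply: differentiable_continuous; case: hC2.
have [i0 i0S] := maximal_independent_neq0 m0 hS.
(* The signs at [i0] are fixed to remove the rotation freedom; the empty pattern is that of the
   ground truth and is discarded. *)
pose D := powerset (finset.setX (S :\ i0) [set: 'I_r]%SET) :\ finset.set0.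
have DP A : A \in D -> [/\ A != finset.set0, forall a, (i0, a) \notin A &
    {in A, forall k, k.1 \in S}].
  rewrite in_setD1 powersetE => /andP[A0 /fintype.subsetP AS].
  split=> // [a|k /AS].
    by apply/negP => /AS; rewrite finset.in_setX /= finset.setD11.
  by case: k => i a; rewrite finset.in_setX /= => /andP[/setD1P[]].
(* There are finitely many patterns, so one neighbourhood of 0 serves all. Membership in [D] stands
   under the existential so that choice yields a total function, with default 0 outside [D]. *)
have near0 : \forall t \near (0 : R), forall A, exists X, A \in D ->
    flip_box S i0 A X /\
    local_minimum (objective g (base S t *m (base S t)^T)
      (induced_measurements G)) X.
  apply: (@filter_forall _ _ _ (nbhs (0 : R))) => A.
  have [AD|nAD] := boolP (A \in D); last by apply: nearW => t; exists 0.
  have [_ A0 _] := DP _ AD.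
  have := flipped_local_minimum hr hS hloop hS2 i0S gc hmin A0.
  by apply: filterS => t [X KX Xmin]; exists X.
(* The punctured neighbourhood provides a nonzero [t], as uniqueness of the completion requires. *)
have [t [tmin t0]] :=
  filter_ex (filterI (nbhs_dnbhs near0) (nbhs_dnbhs_neq (0 : R))).
have [X XP] := choice tmin.
exists (base S t *m (base S t)^T), (induced_measurements G); split.
  apply: gram_in_class (block_rows_base S t) => // i.
  by rewrite /base_weight; case: ifP => // _; exact: oner_neq0.
(* There are [r * (#|S| - 1)] free signs, and the empty pattern accounts for the subtracted 1. *)
have -> : (2 ^ (r * (#|S| - 1)) - 1)%N = #|D|.
  have := cardsD1 finset.set0
    (powerset (finset.setX (S :\ i0) [set: 'I_r]%SET)).
  rewrite powersetE finset.sub0set card_powerset finset.cardsX cardsT card_ord.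
  by move=> e; rewrite (cardsD1 i0 S) i0S addKn mulnC e addKn.
pose C A := [set X' | equivalent (X A) X'].
apply: (@card_le_finset _ D _ _ C) => [A AD|A B AD BD CAB].
  have [A0 _ AS] := DP _ AD; have [KX Xmin] := XP A AD.
  by exists (X A) => //; apply: flipped_spurious KX Xmin => //; exact: hloop.
(* Equal classes make [X A] and [X B] equivalent, so their Gram matrices agree and the boxes
   determine the same pattern. *)
have : C B (X B) by exact: equivalent_refl.
rewrite -CAB => /equivalent_gram XBA.
have [[_ _ AS] [_ _ BS]] := (DP _ AD, DP _ BD).
have [[KA _] [KB _]] := (XP A AD, XP B BD).
exact: flip_box_inj AS BS KA KB (esym XBA).
Qed.
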